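(* Let $n,k,r,q$ be integers such that $r\ge 2$, $q\ge -r+1$ and $n\ge k\ge 2q+2r+2$, and let $C'=(q+r)^{\frac{1}{\lfloor k/(q+r+1)\rfloor}}$. Then $$\mathrm{ex}_M(n,\mathcal{H}^{(r)}_M(k,q)) < \frac{2C'}{r!}\cdot n^{r-1+\frac{1}{\lfloor k/(q+r+1)\rfloor}}+\frac{2(q+r)}{r!}\cdot n^{r-1}.$$
   Context: An $r$-uniform multihypergraph $H$ has a finite vertex set $V(H)$ and a finite multiset $E(H)$ of edges, each edge being an $r$-element subset of $V(H)$; the same $r$-set may occur as an edge several times, and $|E(H)|$ counts edges with multiplicity. Vertices contained in no edge are allowed. A submultihypergraph is obtained by taking a subset of the vertices and a sub-multiset of the edges contained in it (not necessarily induced). For a family $\mathcal{F}$ of $r$-uniform multihypergraphs, $\mathrm{ex}_M(n,\mathcal{F})$ is the maximum number of edges (with multiplicity) in an $r$-uniform multihypergraph on $n$ vertices having no submultihypergraph isomorphic to a member of $\mathcal{F}$. For integers $r\ge 2$, $q\ge -r+1$, $k\ge q+r+1$, $\mathcal{H}^{(r)}_M(k,q)$ is the family of all $r$-uniform multihypergraphs $H$ with $|E(H)|-|V(H)|=q+1$ and $q+r+1\le |E(H)|\le k$. *)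

(* Defs.v *)
From HB Require Import structures.
From mathcomp Require Import all_boot all_order all_algebra.
From mathcomp Require Import all_classical all_reals all_analysis.

Set Implicit Arguments.
Unset Strict Implicit.
Unset Printing Implicit Defensive.

Import Order.TTheory GRing.Theory Num.Theory.
Local Open Scope ring_scope.

(* An r-uniform multihypergraph whose vertices are drawn from the ambient type
   T: the edge multiset is given by its multiplicity function, and [vset] may
   contain vertices lying in no edge. *)
Record mhgraph (r : nat) (T : finType) := MHGraph {
  vset : {set T};
  mult : {ffun {set T} -> nat};
  mult_edge : forall e : {set T},
    (0 < mult e)%N -> #|e| = r /\ e \subset vset
}.

Definition nverts (r : nat) (T : finType) (H : mhgraph r T) : nat := #|vset H|.

Definition nedges (r : nat) (T : finType) (H : mhgraph r T) : nat :=
  (\sum_(e : {set T}) mult H e)%N.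

Definition submh (r : nat) (T : finType) (G H : mhgraph r T) : Prop :=
  vset G \subset vset H /\ forall e : {set T}, (mult G e <= mult H e)%N.

(* The bijection is between the vertex sets, not between the ambient types. *)
Definition mhiso (r : nat) (T U : finType)
    (G : mhgraph r T) (H : mhgraph r U) : Prop :=
  exists f : {x : T | x \in vset G} -> {y : U | y \in vset H},
    bijective f /\
    forall e : {set {x : T | x \in vset G}},
      mult H [set val (f x) | x in e] = mult G [set val x | x in e].

Definition mhfamily (r : nat) := forall U : finType, mhgraph r U -> Prop.

Definition mhfree (r : nat) (Fam : mhfamily r) (T : finType)
    (H : mhgraph r T) : Prop :=
  ~ exists (G : mhgraph r T) (U : finType) (F : mhgraph r U),
      [/\ submh G H, Fam U F & mhiso G F].

(* [is_exM n Fam m] says that ex_M(n, Fam) exists and equals m.  A relation is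
   used because for an arbitrary family the edge counts may be unbounded, or
   there may be no Fam-free multihypergraph at all. *)
Definition is_exM (r n : nat) (Fam : mhfamily r) (m : nat) : Prop :=
  (exists (T : finType) (H : mhgraph r T),
     [/\ nverts H = n, mhfree Fam H & nedges H = m]) /\
  (forall (T : finType) (H : mhgraph r T),
     nverts H = n -> mhfree Fam H -> (nedges H <= m)%N).

Definition HM (r k : nat) (q : int) : mhfamily r :=
  fun U F =>
    (nedges F)%:Z - (nverts F)%:Z = q + 1 /\
    q + r%:Z + 1 <= (nedges F)%:Z <= k%:Z.

(* Main.v *)
Require Import Defs.
From HB Require Import structures.
From mathcomp Require Import all_boot all_order all_algebra.
From mathcomp Require Import all_classical all_reals all_analysis.
From mathcomp Require Import zify lra.
From mathcomp Require Import fintype finset.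

(** Write [p] for [q + r] and [t] for the integer part of [k / (p + 1)], so that
    [p >= 1] and [t >= 2]. A member of the forbidden family on [v] vertices has
    [v + p - r + 1] edges. A
    hypergraph is therefore free of the family exactly when, roughly, every
    small set of vertices carries few edges.

    The first idea is to pass to links. For a set [S] of [r - 2] vertices, the
    pairs that complete [S] to an edge form a multigraph, and adding [S] to a
    dense vertex set of this multigraph gives a dense vertex set of the
    hypergraph ([free_sparse], [spanned_link_le]). So in each link any [v]
    vertices, where [2 <= v <= 1 + t + p (t - 1)], span at most [v + p - 2] edges.
    It suffices to bound the links, because the edges of the links together
    count each edge of the hypergraph [r (r - 1) / 2] times ([nedges_links]) and
    there are at most [n ^ (r - 2) / (r - 2)!] links.

    The multigraph bound ([sparse_spanned_lt]) generalises the bound on graphs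
    of large girth, which is the case [p = 1]. Let [d ^ t = p n]. If there were
    [(d + p) n] edges, some induced submultigraph would have all degrees at least
    [d + p] ([dense_core]). Grow in it a breadth-first search tree to depth
    [t]. A vertex at distance at most [t] sends fewer than [p] non-tree edges to
    vertices at distance less than [t], since the tree paths from the ends of
    [p] such edges to the root would span too many edges on too few vertices
    ([excess_lt]). So up to distance [t - 2] every vertex has at least [d]
    children, and the root has [d + 1] ([layer_growth]). Between the last two
    layers each vertex sends [d] edges forward, while each vertex of the last
    layer receives at most [p] ([last_layer]). Hence [p] times the size of the
    last layer is at least [d ^ (t - 1) (d + 1) > p n], which is impossible
    ([layers_count]).

    The maximum exists because the edge numbers of free hypergraphs are bounded
    by the same argument and the hypergraph without edges is free. *)

Set Implicit Arguments.
Unset Strict Implicit.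
Unset Printing Implicit Defensive.

Import Order.TTheory GRing.Theory Num.Theory.
Local Open Scope nat_scope.

(** * Sums over finite sets *)

(** It is enough to choose elements with positive value: each contributes at least
    one to the sum. *)
Lemma small_subset_sum (T : finType) (f : T -> nat) (Q : {set T}) p :
  p <= \sum_(v in Q) f v ->
  exists W : {set T}, [/\ W \subset Q, #|W| <= p & p <= \sum_(v in W) f v].
Proof.
elim: p => [|p IHp] lep; first by exists set0; rewrite sub0set cards0.
have [W [WQ cW fW]] := IHp (ltnW lep).
have [lt_p|le_p] := ltnP p (\sum_(v in W) f v); first by exists W; split=> //; lia.
have /exists_inP[v vQ vW] : [exists v in Q, (v \notin W) && (0 < f v)].
  apply: contraTT lep; rewrite negb_exists_in => /forall_inP H.
  rewrite -ltnNge ltnS (big_setID W) /= (setIidPr WQ).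
  rewrite [X in _ + X]big1 ?addn0 // => v; rewrite inE => /andP[vW vQ].
  by have := H v vQ; rewrite vW /= -eqn0Ngt => /eqP.
case/andP: vW => vW fv; exists (v |: W); split.
- by rewrite subUset sub1set vQ.
- by rewrite cardsU1 vW; lia.
- by rewrite big_setU1 //=; lia.
Qed.

(** The row and the column of [u] meet only at the diagonal, which [W] avoids. *)
Lemma star_sum (T : finType) (f : T -> T -> nat) (A W : {set T}) u :
  (forall a b, f a b = f b a) -> u \in A -> u \notin W -> W \subset A ->
  2 * \sum_(v in W) f u v <= \sum_(a in A) \sum_(b in A) f a b.
Proof.
move=> f_sym uA uW WA; rewrite (bigD1 u uA) mul2n -addnn /=; apply: leq_add.
  by rewrite [leqRHS](big_setID W) (setIidPr WA) leq_addr.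
apply: leq_trans (_ : \sum_(a in A | a != u) f a u <= _); last first.
  by apply: leq_sum => a _; rewrite (bigD1 u uA) leq_addr.
rewrite (eq_bigr (f^~ u)) // big_mkcond [leqRHS]big_mkcond.
apply: leq_sum => a _; case: ifP => // aW; rewrite (subsetP WA) //=.
by case: eqVneq aW => // ->; rewrite (negbTE uW).
Qed.

(** Both sides count the sets [e] of size [j + 1] with a distinguished element. *)
Lemma sum_setU1_card (T : finType) (F : {set T} -> nat) j :
  \sum_(S : {set T} | #|S| == j) \sum_(u | u \notin S) F (u |: S) =
  j.+1 * \sum_(e : {set T} | #|e| == j.+1) F e.
Proof.
rewrite big_distrr /=.
under [RHS]eq_bigr => e /eqP <- do rewrite -sum_nat_const.
rewrite (exchange_big_dep predT) //= [RHS](exchange_big_dep predT) //=.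
apply: eq_bigr => u _.
rewrite [RHS](reindex_onto (fun S => u |: S) (fun e => e :\ u)) /=; last first.
  by move=> e /andP[_ ue]; rewrite setD1K.
apply: eq_bigl => S; rewrite setU11 andbT cardsU1.
have [uS|uS] := boolP (u \in S); last by rewrite eqSS setU1K // eqxx.
rewrite /= andbF; apply/esym/negbTE; rewrite negb_and; apply/orP; right.
by apply: contraTneq uS => <-; rewrite !inE eqxx.
Qed.

(** Multisets are thinned to any prescribed smaller size. *)
Lemma sub_multiset (X : finType) (f : X -> nat) m :
  m <= \sum_e f e ->
  exists g : {ffun X -> nat}, (forall e, g e <= f e) /\ \sum_e g e = m.
Proof.
elim: m => [|m IHm] le_m.
  by exists [ffun=> 0]; split=> [e|]; [rewrite ffunE | rewrite big1 // => e; rewrite ffunE].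
have [g [gf gm]] := IHm (ltnW le_m).
have /existsP[e ge] : [exists e, g e < f e].
  apply: contraTT le_m; rewrite negb_exists => /forallP gf'.
  by rewrite -ltnNge ltnS -gm leq_sum // => e _; rewrite leqNgt gf'.
exists [ffun a => g a + (a == e)]; split=> [a|].
  by rewrite ffunE; case: eqVneq => [->|_]; rewrite ?addn1 // addn0.
under eq_bigr => a _ do rewrite ffunE.
rewrite big_split /= gm (bigD1 e) //= eqxx big1 ?addn1 // => a.
by move=> /negbTE->.
Qed.

(** * Locally sparse multigraphs *)

Section Multigraph.
Variables (T : finType) (w : T -> T -> nat).

Definition spanned (A : {set T}) := \sum_(u in A) \sum_(v in A) w u v.

(** The factors two and the offset are those of ordered pairs: since [spanned]
    counts each edge twice, this says that [A] carries at most [#|A| + p - 2]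
    edges. *)
Definition locally_sparse (V : {set T}) s p :=
  forall A : {set T}, A \subset V -> 1 < #|A| -> #|A| <= s ->
    spanned A + 2 < 2 * (#|A| + p).

Definition degree_in (A : {set T}) u := \sum_(v in A) w u v.

(** A breadth-first search tree of depth [t] with root [x]. Vertices of [V] that
    are not reached within [t] steps may have any distance larger than [t] and
    any parent; vertices outside [V] are unconstrained. *)
Record layering (V : {set T}) (x : T) (t : nat)
    (dist : T -> nat) (par : T -> T) : Prop := Layering {
  layering_root : dist x = 0;
  layering_par : forall v, v \in V -> dist v <= t -> v != x ->
    [/\ par v \in V, dist v = (dist (par v)).+1 & 0 < w (par v) v];
  layering_edge : forall u v, u \in V -> v \in V -> 0 < w u v ->
    dist u < t -> dist v <= (dist u).+1 }.

(** The balls around [x] in [V] are iterated neighbourhoods; the distance of a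
    vertex is the index of the first of the balls of radius at most [t] that
    contains it, and a parent is any neighbour that is one step closer. *)
Lemma layering_exists (V : {set T}) (x : T) (t : nat) :
  x \in V -> exists dist par, layering V x t dist par.
Proof.
move=> xV.
pose ball i :=
  iter i (fun B => B :|: [set v in V | [exists u in B, 0 < w u v]]) [set x].
pose dist v := find (fun i => v \in ball i) (iota 0 t.+1).
have ballS i v : (v \in ball i.+1) =
    (v \in ball i) || (v \in V) && [exists u in ball i, 0 < w u v].
  by rewrite /ball iterS !inE.
have ball_mono i j v : i <= j -> v \in ball i -> v \in ball j.
  move=> /subnK <-; elim: (j - i) => // m IHm vi.
  by rewrite addSn ballS IHm.
have ballV i v : v \in ball i -> v \in V.
  elim: i => [|i IHi]; first by rewrite inE => /eqP->.
  by rewrite ballS => /orP[/IHi //|/andP[]].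
have distP i v : i <= t -> (dist v <= i) = (v \in ball i).
  move=> it; apply/idP/idP => [le_di|vi].
    have: has (fun i => v \in ball i) (iota 0 t.+1).
      by rewrite has_find size_iota -/(dist v); lia.
    move=> /(nth_find 0); rewrite -/(dist v) nth_iota ?add0n; last by lia.
    exact: ball_mono.
  rewrite leqNgt; apply/negP => lt_id.
  by have := before_find 0 lt_id; rewrite nth_iota ?add0n ?vi; last by lia.
pose par v := odflt v
  [pick u | [&& u \in V, dist v == (dist u).+1 & 0 < w u v]].
exists dist, par; split.
- by apply/eqP; rewrite -leqn0 distP //= inE.
- move=> v vV dvt vx; rewrite /par; case: pickP => [u /and3P[uV /eqP? ?] //|no].
  case E: (dist v) dvt => [|i] it.
    by move: (distP 0 v isT); rewrite E inE (negbTE vx).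
  have : v \in ball i.+1 by rewrite -distP ?E.
  have vNi: v \notin ball i by rewrite -distP ?E; lia.
  rewrite ballS (negbTE vNi) /= => /andP[_ /exists_inP[u ui wuv]].
  have := no u; rewrite (ballV _ _ ui) wuv andbT E eqSS.
  suff -> : dist u = i by rewrite eqxx.
  apply/eqP; rewrite eqn_leq distP ?ui ?(ltnW it) //= leqNgt; apply/negP.
  case: i it vNi {E ui} => // i it vNi; rewrite ltnS distP; last by lia.
  move=> ui; case/negP: vNi; rewrite ballS vV /=; apply/orP; right.
  by apply/exists_inP; exists u.
move=> u v uV vV wuv dut; rewrite distP // ballS vV /=; apply/orP; right.
by apply/exists_inP; exists u => //; rewrite -distP // ltnW.
Qed.

Section Layered.
Variables (V : {set T}) (x : T) (t : nat) (dist : T -> nat) (par : T -> T).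
Hypothesis (w_sym : forall u v, w u v = w v u) (w_irr : forall u, w u u = 0).
Hypothesis (xV : x \in V) (lay : layering V x t dist par).

(** Vertex sets of subtrees containing the root. *)
Definition rooted (A : {set T}) :=
  [/\ x \in A, forall v, v \in A -> v \in V /\ dist v <= t
    & forall v, v \in A -> v != x -> par v \in A].

Lemma rooted1 : rooted [set x].
Proof.
split=> [|v|v]; rewrite inE ?eqxx // => /eqP->; last by rewrite eqxx.
by rewrite (layering_root lay).
Qed.

(** Adding [v] requires adding only the part of its path to the root outside
    [A]; the root itself is already there, so [dist v] new vertices suffice. *)
Lemma rooted_add A v : rooted A -> v \in V -> dist v <= t ->
  exists A', [/\ rooted A', A \subset A', v \in A' & #|A'| <= #|A| + dist v].
Proof.
move=> rA; move: {2}(dist v) (erefl (dist v)) => i.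
elim: i v => [|i IHi] v Ei vV vt; have [vA|vNA] := boolP (v \in A);
  try by exists A; split=> //; apply: leq_addr.
  case/negP: vNA; have [->|vx] := eqVneq v x; first by case: rA.
  by have [_] := layering_par lay vV vt vx; rewrite Ei.
have vx : v != x by apply: contraNneq vNA => ->; case: rA.
have [pV dv wp] := layering_par lay vV vt vx.
have [||B [[xB BV Bpar] AB pB cB]] := IHi (par v) _ pV; try lia.
exists (v |: B); split; last by rewrite cardsU1; lia.
- split; first by rewrite !inE xB orbT.
  + by move=> u; rewrite !inE => /orP[/eqP-> //|]; apply: BV.
  + move=> u; rewrite !inE => /orP[/eqP-> _|uB ux]; first by rewrite pB orbT.
    by rewrite (Bpar _ uB ux) orbT.
- by rewrite (subset_trans AB) ?subsetUr.
- by rewrite !inE eqxx.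
Qed.

Lemma rooted_addn A (W : {set T}) s : rooted A -> s <= t ->
  (forall v, v \in W -> v \in V /\ dist v <= s) ->
  exists A', [/\ rooted A', A \subset A', W \subset A'
               & #|A'| <= #|A| + #|W| * s].
Proof.
move=> rA st; move: {2}#|W| (erefl #|W|) => m.
elim: m W => [|m IHm] W cW sW.
  exists A; split=> //; last by rewrite cW addn0.
  by move/eqP: cW; rewrite cards_eq0 => /eqP->; apply: sub0set.
have /card_gt0P[v vW] : 0 < #|W| by rewrite cW.
have cW' : #|W :\ v| = m by move: (cardsD1 v W); rewrite vW cW; lia.
have [|B [rB AB WB cB]] := IHm _ cW'.
  by move=> u; rewrite !inE => /andP[_ /sW].
have [vV vs] := sW v vW.
have [|C [rC BC vC cC]] := rooted_add rB vV; first by lia.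
exists C; split=> //; first exact: subset_trans BC.
  by rewrite -(setD1K vW) subUset sub1set vC (subset_trans WB).
by rewrite cW; rewrite cW' in cB; lia.
Qed.

Definition tree_arc u v : nat := (u != x) && (par u == v).

(** Multiplicity of the pair outside the search tree: one copy of each tree edge
    is removed. For two vertices of the tree the subtraction is exact, by
    [tree_arcs_le]. *)
Definition excess u v := w u v - (tree_arc u v + tree_arc v u).

Lemma tree_arc_dist u v : u \in V -> dist u <= t -> 0 < tree_arc u v ->
  dist u = (dist v).+1.
Proof.
move=> uV ut; rewrite /tree_arc lt0b => /andP[ux /eqP<-].
by have [] := layering_par lay uV ut ux.
Qed.

Lemma tree_arcs_le u v : u \in V -> v \in V -> dist u <= t -> dist v <= t ->
  tree_arc u v + tree_arc v u <= w u v.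
Proof.
move=> uV vV ut vt.
have luv := tree_arc_dist uV ut (v := v); have lvu := tree_arc_dist vV vt (v := u).
have: (0 < tree_arc u v -> 0 < w u v) /\ (0 < tree_arc v u -> 0 < w u v).
  split; rewrite /tree_arc lt0b => /andP[nx /eqP<-].
    by rewrite w_sym; case: (layering_par lay uV ut nx).
  by case: (layering_par lay vV vt nx).
have l1 a b : tree_arc a b <= 1 by apply: leq_b1.
move: (l1 u v) (l1 v u) => ? ? [? ?].
have [l0|lp] := posnP (tree_arc u v); have [l0'|lp'] := posnP (tree_arc v u); try lia.
Qed.

Lemma sum_tree_arc_le (P : pred T) u : \sum_(v | P v) tree_arc u v <= (u != x).
Proof.
rewrite /tree_arc; case: (u != x) => /=; last by rewrite big1.
rewrite big_mkcond (bigD1 (par u)) //= eqxx big1 => [|v vp]; first by case: ifP.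
by rewrite eq_sym (negbTE vp); case: ifP.
Qed.

(** A subtree on [#|A|] vertices has [#|A| - 1] edges, one for each vertex other
    than the root; everything else that [A] spans is excess. *)
Lemma spanned_rooted A : rooted A ->
  spanned A = 2 * (#|A| - 1) + \sum_(u in A) \sum_(v in A) excess u v.
Proof.
case=> xA AV Apar.
have arc_sum : \sum_(u in A) \sum_(v in A) tree_arc u v = #|A| - 1.
  transitivity (\sum_(u in A) (u != x)); last first.
    rewrite (bigD1 x) //= eqxx add0n (eq_bigr (fun=> 1)) => [|u /andP[_ -> //]].
    rewrite sum1_card (cardsD1 x A) xA add1n subn1 /=.
    by apply: eq_card => u; rewrite !inE andbC.
  apply: eq_bigr => u uA; rewrite /tree_arc; have [_|ux] /= := eqVneq u x.
    by rewrite big1.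
  rewrite (bigD1 (par u)) ?Apar //= eqxx big1 // => v /andP[_ vp].
  by rewrite eq_sym (negbTE vp).
rewrite /spanned mul2n -addnn -{1}arc_sum -{1}arc_sum.
rewrite [X in _ + X + _]exchange_big -!big_split; apply: eq_bigr => u uA.
rewrite -!big_split; apply: eq_bigr => v vA /=.
have [uV ut] := AV _ uA; have [vV vt] := AV _ vA.
by rewrite subnKC // tree_arcs_le.
Qed.

Lemma excess_sym u v : excess u v = excess v u.
Proof. by rewrite /excess w_sym addnC. Qed.

Lemma excess_irr u : excess u u = 0.
Proof. by rewrite /excess w_irr. Qed.

Variable (p : nat).
Hypothesis (t_gt0 : 0 < t) (p_gt0 : 0 < p).
Hypothesis sparse : locally_sparse V (1 + t + p * t.-1) p.

(** The step where local sparseness is used. If [p] excess edges joined [u] to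
    vertices at distance less than [t], then their at most [p] other ends could
    be joined to the root inside the tree, together with [u], by a subtree with
    at most [1 + t + p * (t - 1)] vertices: the root, [t] vertices for [u], and
    [t - 1] for each of the other ends. This subtree would span [p] edges more
    than a tree. *)
Lemma excess_lt u : u \in V -> dist u <= t ->
  \sum_(v in V | dist v < t) excess u v < p.
Proof.
move=> uV ut; rewrite ltnNge; apply/negP => le_p.
pose Q : {set T} := [set v in V | dist v < t].
have [|W0 [W0Q cW0 pW0]] := @small_subset_sum _ (excess u) Q p.
  by rewrite (eq_bigl (fun v => (v \in V) && (dist v < t))) // => v; rewrite inE.
pose W := W0 :\ u.
have pW : p <= \sum_(v in W) excess u v.
  apply: leq_trans pW0 _; have [uW|uW] := boolP (u \in W0).
    by rewrite (big_setD1 u uW) /= excess_irr.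
  by rewrite /W (setDidPl _) // disjoint_sym disjoints1.
have WQ : W \subset Q by rewrite (subset_trans _ W0Q) ?subsetDl.
have cW : #|W| <= p by rewrite (leq_trans _ cW0) ?subset_leq_card ?subsetDl.
have uW : u \notin W by rewrite !inE eqxx.
have [A1 [rA1 _ uA1 cA1]] := rooted_add rooted1 uV ut.
have [||A [rA A1A WA cA]] := @rooted_addn A1 W t.-1 rA1; first exact: leq_pred.
  by move=> v /(subsetP WQ); rewrite inE => /andP[-> vt]; split=> //; lia.
have uA := subsetP A1A _ uA1.
have AV : A \subset V by apply/subsetP => v; case: rA => _ AV _ /AV[].
have A_gt1 : 1 < #|A|.
  have [W_eq0|[v vW]] := set_0Vmem W.
    by move: pW; rewrite W_eq0 big_set0 leqNgt p_gt0.
  have <- : #|[set u; v]| = 2.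
    by rewrite cards2; case: eqVneq vW uW => // -> ->.
  rewrite subset_leq_card // subUset !sub1set uA.
  exact: (subsetP WA).
have cA_le : #|A| <= 1 + t + p * t.-1.
  rewrite (leq_trans cA) // leq_add ?leq_mul2r ?cW ?orbT //.
  by rewrite (leq_trans cA1) // cards1 leq_add2l.
have := sparse AV A_gt1 cA_le; rewrite (spanned_rooted rA).
have := star_sum excess_sym uA uW WA; lia.
Qed.

(** Edges from [u] to vertices at distance less than [t] are excess edges, of
    which there are fewer than [p], the edge to the parent, or edges to
    children. *)
Lemma inward_degree_lt u : u \in V -> dist u <= t ->
  \sum_(v in V | dist v < t) w u v <
  p + (u != x) + \sum_(v in V | dist v < t) tree_arc v u.
Proof.
move=> uV ut; have := excess_lt uV ut.
have := sum_tree_arc_le [pred v | (v \in V) && (dist v < t)] u => /=.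
set E := \sum_(v in V | _) excess u v; set L := \sum_(v in V | _) tree_arc u v.
set L' := \sum_(v in V | _) tree_arc v u.
suff: \sum_(v in V | dist v < t) w u v <= L + L' + E by lia.
by rewrite -!big_split leq_sum // => v _; rewrite /= -leq_subLR.
Qed.

Definition layer i : {set T} := [set v in V | dist v == i].

Lemma layer0 : layer 0 = [set x].
Proof.
apply/setP => v; rewrite !inE; apply/andP/eqP => [[vV /eqP dv]|->].
  apply/eqP/negPn/negP => vx.
  by have [|_] := layering_par lay vV _ vx; rewrite dv.
by rewrite xV (layering_root lay).
Qed.

Lemma sum_children_le i :
  \sum_(u in layer i) \sum_(v in V | dist v < t) tree_arc v u <= #|layer i.+1|.
Proof.
rewrite exchange_big -sum1_card big_mkcond [leqRHS]big_mkcond.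
apply: leq_sum => v _; case: ifP => // /andP[vV vt].
have [vL|vL] := boolP (v \in layer i.+1).
  by rewrite (leq_trans (sum_tree_arc_le _ _)) // leq_b1.
rewrite big1 // => u; rewrite inE => /andP[uV /eqP du].
apply: contraNeq vL; rewrite -lt0n => /(tree_arc_dist vV (ltnW vt)) dv.
by rewrite inE vV dv du eqxx.
Qed.

(** Up to distance [t - 2] every neighbour is at distance less than [t], so all
    but at most [p] of the edges at [u] lead to children of [u], and distinct
    vertices have disjoint sets of children. No factor [p] is lost here. *)
Lemma layer_growth i : i.+1 < t ->
  \sum_(u in layer i) (degree_in V u).+1 <=
  \sum_(u in layer i) (p + (u != x)) + #|layer i.+1|.
Proof.
move=> it; apply: leq_trans (leq_add (leqnn _) (sum_children_le i)).
rewrite -big_split; apply: leq_sum => u; rewrite inE => /andP[uV /eqP du].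
have ut : dist u <= t by lia.
apply: leq_trans (inward_degree_lt uV ut); rewrite ltnS /degree_in.
rewrite (bigID (fun v => dist v < t)) /= [X in _ + X]big1 ?addn0 // => v.
move=> /andP[vV /negP vt]; apply/eqP; rewrite -leqn0 leqNgt; apply/negP => wuv.
by have := layering_edge lay uV vV wuv; lia.
Qed.

(** Vertices at distance [t] need not be counted by their parents: a vertex of
    the last layer receives at most [p] edges from the previous one, so a double
    count of the edges between the two layers loses a factor [p], once. *)
Lemma last_layer i : i.+1 = t ->
  \sum_(u in layer i) degree_in V u <= #|layer i| * p + #|layer t| * p.
Proof.
move=> it; rewrite -!sum_nat_const.
have cross : \sum_(v in layer t) \sum_(u in layer i) w v u <=
             \sum_(v in layer t) p.
  apply: leq_sum => v; rewrite inE => /andP[vV /eqP dv].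
  have := inward_degree_lt vV; rewrite dv leqnn => /(_ isT).
  rewrite [X in _ < _ + X]big1 => [|u /andP[uV ut]]; last first.
    apply/eqP; rewrite -leqn0 leqNgt; apply/negP.
    by move=> /(tree_arc_dist uV (ltnW ut)); lia.
  have b1 : (v != x) <= 1 by apply: leq_b1.
  suff: \sum_(u in layer i) w v u <= \sum_(u in V | dist u < t) w v u by lia.
  rewrite big_mkcond [leqRHS]big_mkcond leq_sum // => u _; rewrite inE.
  by case: ifP => // /andP[-> /eqP ->]; rewrite -it ltnSn.
apply: leq_trans (leq_add (leqnn _) cross).
rewrite [X in _ + X]exchange_big -big_split /=.
apply: leq_sum => u; rewrite inE => /andP[uV /eqP du].
rewrite /degree_in (bigID (fun v => dist v < t)) /= leq_add //.
  have ut : dist u <= t by lia.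
  have b1 : (u != x) <= 1 by apply: leq_b1.
  have := inward_degree_lt uV ut; rewrite [X in _ < _ + X]big1 => [|v /andP[vV vt]].
    by lia.
  apply/eqP; rewrite -leqn0 leqNgt; apply/negP.
  by move=> /(tree_arc_dist vV (ltnW vt)); lia.
rewrite big_mkcond [leqRHS]big_mkcond leq_sum // => v _; rewrite inE.
case: ifP => // /andP[vV /negP vt]; rewrite vV /= (w_sym v); case: eqP => // vt'.
rewrite leqNgt; apply/negP => wuv.
by have := layering_edge lay uV vV wuv; lia.
Qed.

End Layered.

(** A minimal set of density at least [c] works: deleting a vertex of degree less
    than [c] would leave a set of density larger than [c], which is not empty because
    the empty set spans nothing. *)
Lemma dense_core (R : realFieldType) (V : {set T}) (c : R) :
  (forall u v, w u v = w v u) -> (forall u, w u u = 0) -> V != set0 ->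
  (2 * c * #|V|%:R <= (spanned V)%:R)%R ->
  exists (V' : {set T}) (x : T), [/\ V' \subset V, x \in V'
    & forall u, u \in V' -> (c <= (degree_in V' u)%:R)%R].
Proof.
move=> w_sym w_irr V0 dense.
pose P (A : {set T}) := (A != set0) && (2 * c * #|A|%:R <= (spanned A)%:R)%R.
have [V' /minsetP[/andP[V'0 dense'] minV'] V'V] :=
  @minset_exists _ P V (introT andP (conj V0 dense)).
have /set0Pn[x xV'] := V'0.
exists V', x; split=> // u uV'; rewrite leNgt; apply/negP => du.
have split_spanned : spanned V' = 2 * degree_in V' u + spanned (V' :\ u).
  rewrite /spanned (big_setD1 u uV') /= -/(degree_in V' u) mul2n -addnn -addnA.
  congr (_ + _).
  under eq_bigr => a _ do rewrite (big_setD1 u uV').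
  rewrite big_split /=; congr (_ + _).
  rewrite /degree_in (big_setD1 u uV') /= w_irr add0n.
  by apply: eq_bigr => a _; apply: w_sym.
have cV' : #|V'| = #|V' :\ u|.+1 by rewrite (cardsD1 u V') uV'.
have dense_rest : (2 * c * #|V' :\ u|%:R < (spanned (V' :\ u))%:R)%R.
  move: dense'; rewrite split_spanned cV' -natr1 natrD natrM; lra.
have PVu : P (V' :\ u).
  rewrite /P (ltW dense_rest) andbT; apply: contraTneq dense_rest => ->.
  by rewrite cards0 mulr0 /spanned big_set0 ltxx.
have := minV' _ PVu (subD1set _ _) => Vu.
by move: uV'; rewrite -Vu !inE eqxx.
Qed.

(** The layers grow by a factor [d], with one more vertex in the first one, up to
    distance [t - 1], and the last layer has at least [d / p] times as many
    vertices as the previous one. *)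
Lemma layers_count (R : realFieldType) (V : {set T}) (x : T) (t p : nat) (d : R) :
  (forall u v, w u v = w v u) -> (forall u, w u u = 0) ->
  x \in V -> 1 < t -> 0 < p -> (0 < d)%R ->
  locally_sparse V (1 + t + p * t.-1) p ->
  (forall u, u \in V -> (d + p%:R <= (degree_in V u)%:R)%R) ->
  (d ^+ t < p%:R * #|V|%:R)%R.
Proof.
move=> w_sym w_irr xV t_gt1 p_gt0 d_gt0 sparse deg.
have [dist [par lay]] := layering_exists t xV.
have t_gt0 := ltnW t_gt1.
pose L i : {set T} := layer V dist i.
have growth i : i.+1 < t ->
    (#|L i|%:R * (d + p%:R + 1) <=
     (\sum_(u in L i) (p + (u != x)) + #|L i.+1|)%:R)%R.
  move=> it; have := layer_growth w_sym w_irr xV lay t_gt0 p_gt0 sparse it.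
  rewrite -(ler_nat R); apply: le_trans.
  rewrite natr_sum mulr_natl -sumr_const ler_sum // => u.
  by rewrite inE => /andP[uV _]; rewrite -natr1 lerD2r deg.
have expand i : i.+1 < t -> (d ^+ i * (d + 1) <= #|L i.+1|%:R)%R.
  elim: i => [|i IHi] it; have := growth _ it.
    rewrite /L (layer0 xV lay) cards1 big_set1 eqxx expr0 addn0 natrD; lra.
  move=> grow; have {}IHi := IHi (ltnW it).
  have : (#|L i.+1|%:R * (d + p%:R + 1) <=
          #|L i.+1|%:R * (p%:R + 1) + #|L i.+2|%:R :> R)%R.
    apply: le_trans grow _; rewrite natrD lerD2r natr1 -natrM ler_nat.
    rewrite -sum_nat_const leq_sum // => u _.
    by rewrite -addn1 leq_add2l leq_b1.
  have := ler_wpM2l (ltW d_gt0) IHi; rewrite exprS; lra.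
case: t t_gt1 @L growth expand lay sparse t_gt0 => [|[|s]] // _ L _ expand lay sparse _.
have {expand} := expand s (ltnSn _).
have := last_layer w_sym w_irr xV lay isT p_gt0 sparse (erefl s.+2).
rewrite -(ler_nat R) natrD !natrM -!/(L _) => last expand.
have lower : (#|L s.+1|%:R * (d + p%:R) <=
              (\sum_(u in L s.+1) degree_in V u)%:R)%R.
  rewrite natr_sum mulr_natl -sumr_const ler_sum // => u.
  by rewrite inE => /andP[/deg].
have LV : (p%:R * #|L s.+2|%:R <= p%:R * #|V|%:R :> R)%R.
  rewrite ler_wpM2l // ler_nat subset_leq_card //.
  by apply/subsetP => u; rewrite inE => /andP[].
have := ler_wpM2l (ltW d_gt0) expand.
have : (0 < d ^+ s.+1)%R by apply: exprn_gt0.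
rewrite !exprS; lra.
Qed.

(** The bound for multigraphs; it is essentially the case of uniformity two of the
    final theorem, with [d] in place of the root of [p * #|V|] of order [t]. *)
Lemma sparse_spanned_lt (R : realFieldType) (V : {set T}) (t p : nat) (d : R) :
  (forall u v, w u v = w v u) -> (forall u, w u u = 0) ->
  V != set0 -> 1 < t -> 0 < p -> (0 < d)%R ->
  (p%:R * #|V|%:R <= d ^+ t)%R ->
  locally_sparse V (1 + t + p * t.-1) p ->
  ((spanned V)%:R < 2 * (d + p%:R) * #|V|%:R)%R.
Proof.
move=> w_sym w_irr V0 t_gt1 p_gt0 d_gt0 le_pV sparse.
rewrite ltNge; apply/negP => dense.
have [V' [x [V'V xV' deg]]] := dense_core w_sym w_irr V0 dense.
have : (d ^+ t < p%:R * #|V'|%:R)%R.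
  apply: (layers_count w_sym w_irr xV') => // A AV'.
  by apply: sparse; apply: subset_trans V'V.
rewrite ltNge => /negP[]; apply: le_trans le_pV.
by rewrite ler_wpM2l // ler_nat subset_leq_card.
Qed.

End Multigraph.

(** * Links of multihypergraphs *)

Lemma mhiso_refl r (T : finType) (G : mhgraph r T) : mhiso G G.
Proof. by exists id; split=> //; exists id. Qed.

(** The edge is pulled back vertex by vertex, which is possible because it lies
    in the vertex set. *)
Lemma mhiso_edge r (T U : finType) (G : mhgraph r T) (F : mhgraph r U)
    (e : {set U}) :
  mhiso G F -> (0 < mult F e)%N -> exists e' : {set T}, (0 < mult G e')%N.
Proof.
case=> f [[g _ gK] fE] Fe; have [_ /subsetP eF] := mult_edge Fe.
pose e' := [set g y | y : {y : U | y \in vset F} & val y \in e].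
exists [set val x | x in e']; rewrite -fE.
suff -> : [set val (f x) | x in e'] = e by [].
apply/setP => y; apply/imsetP/idP => [[_ /imsetP[z + ->] ->]|ye].
  by rewrite inE gK.
exists (g (exist _ y (eF y ye))); last by rewrite gK.
by apply/imsetP; exists (exist _ y (eF y ye)); rewrite ?inE.
Qed.

(** A set [B] with too many edges contains a member of the family on the vertex
    set [B] itself, since surplus edges can be discarded. *)
Lemma free_sparse r k (q : int) (T : finType) (H : mhgraph r T) (B : {set T}) m :
  mhfree (@HM r k q) H -> B \subset vset H ->
  (m%:Z - #|B|%:Z = q + 1)%R -> (q + r%:Z + 1 <= m%:Z)%R -> m <= k ->
  \sum_(e : {set T} | e \subset B) mult H e < m.
Proof.
move=> freeH BH m_excess m_ge m_le; rewrite ltnNge big_mkcond; apply/negP.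
case/sub_multiset=> g [g_le g_sum].
have g_edge e : 0 < g e -> #|e| = r /\ e \subset B.
  move=> ge; have := leq_trans ge (g_le e); case: ifP => // eB He.
  by have [] := mult_edge He.
apply: freeH; exists (MHGraph g_edge), T, (MHGraph g_edge).
split; last exact: mhiso_refl.
- by split=> //= e; apply: leq_trans (g_le e) _; case: ifP.
- by rewrite /HM /nedges /nverts /= g_sum; split=> //; rewrite m_ge /= lez_nat.
Qed.

Section Links.
Variables (r : nat) (T : finType) (H : mhgraph r T).

(** The link of [S], a multigraph when [S] has two vertices fewer than an edge.
    The edges through [S] are not required to have their other vertices outside
    [S]: the remaining pairs get multiplicity zero because the resulting sets
    are too small. *)
Definition link_graph (S : {set T}) (u v : T) := mult H (v |: (u |: S)).

Lemma mult_card (e : {set T}) : #|e| != r -> mult H e = 0.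
Proof.
by move=> er; apply/eqP; rewrite -leqn0 leqNgt; apply: contra er => /mult_edge[-> _].
Qed.

Lemma mult_subset (e : {set T}) : ~~ (e \subset vset H) -> mult H e = 0.
Proof.
by move=> eV; apply/eqP; rewrite -leqn0 leqNgt; apply: contra eV => /mult_edge[].
Qed.

Lemma link_graph_sym (S : {set T}) u v : link_graph S u v = link_graph S v u.
Proof. by rewrite /link_graph setUCA. Qed.

Lemma link_graph_irr (S : {set T}) u : r = #|S|.+2 -> link_graph S u u = 0.
Proof.
move=> rS; apply: mult_card; rewrite setUA setUid cardsU1 rS.
by case: (u \notin S); lia.
Qed.

(** An edge [e] of the hypergraph arises from at most two ordered pairs, the two
    orderings of [e :\: S]. *)
Lemma spanned_link_le (S A : {set T}) : r = #|S|.+2 -> [disjoint A & S] ->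
  spanned (link_graph S) A <=
  2 * \sum_(e : {set T} | e \subset A :|: S) mult H e.
Proof.
move=> rS dAS; rewrite /spanned pair_big /=.
pose h (z : T * T) := z.2 |: (z.1 |: S).
rewrite (partition_big h (fun e : {set T} => e \subset A :|: S)) /=; last first.
  move=> [u v] /andP[/= uA vA]; rewrite /h !subUset !sub1set !inE uA vA /=.
  by rewrite subsetUr.
rewrite big_distrr /= leq_sum // => e _.
rewrite (eq_bigr (fun=> mult H e)) => [|z /andP[_ /eqP<- //]].
have [->|/mult_edge[er _]] := posnP (mult H e); first by rewrite big1.
rewrite sum_nat_const leq_mul2r; apply/orP; right.
set Z := (X in #|X| <= 2).
have [/pred0P Z0|] := boolP (pred0b Z); first by rewrite (eq_card0 Z0).
case/pred0Pn=> -[a b] /= /andP[/andP[/= aA bA] /eqP he].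
apply: leq_trans (_ : #|[set (a, b); (b, a)]| <= 2); last first.
  by rewrite cards2; case: (_ != _).
apply: subset_leq_card; apply/subsetP => -[u v].
rewrite !inE => /andP[/andP[/= uA vA] /eqP he'].
have notS c : c \in A -> c \notin S by move=> cA; rewrite (disjointFr dAS cA).
have in_ab c : c \in A -> c \in e -> (c == a) || (c == b).
  by move=> cA; rewrite -he !inE (negbTE (notS c cA)) orbF orbC.
have ue : (u == a) || (u == b) by rewrite in_ab // -he' !inE eqxx orbT.
have ve : (v == a) || (v == b) by rewrite in_ab // -he' !inE eqxx.
have uv : u != v.
  apply: contra_eqN er => /eqP uv; rewrite -he' /h uv /= setUA setUid cardsU1 rS.
  by rewrite -(addn1 #|S|) -addnS; case: (v \notin S); lia.
move: uv; rewrite !xpair_eqE.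
by case/orP: ue => /eqP->; case/orP: ve => /eqP->; rewrite !eqxx ?orbT.
Qed.

End Links.

(** Each edge lies over [r.+2 * r.+1] triples consisting of a set [S] and an
    ordered pair of vertices; sets [S] and vertices outside [vset H] contribute
    nothing. *)
Lemma nedges_links r (T : finType) (H : mhgraph r.+2 T) :
  r.+2 * r.+1 * nedges H <=
  \sum_(S : {set T} | (S \subset vset H) && (#|S| == r))
     spanned (link_graph H S) (vset H :\: S).
Proof.
rewrite /nedges.
have -> : \sum_e mult H e = \sum_(e : {set T} | #|e| == r.+2) mult H e.
  rewrite [RHS]big_mkcond; apply: eq_bigr => e _.
  by case: ifP => // /negbT; apply: mult_card.
rewrite mulnAC -sum_setU1_card mulnC.
rewrite -(sum_setU1_card (fun S => \sum_(u | u \notin S) mult H (u |: S))).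
rewrite big_mkcond [leqRHS]big_mkcond leq_sum // => S _.
case: (#|S| == r); rewrite ?andbT //=.
have [SV|SV] := boolP (S \subset vset H); last first.
  rewrite big1 // => u _; rewrite big1 // => v _; apply: mult_subset.
  by apply: contra SV; apply: subset_trans; rewrite setUA subsetUr.
rewrite /spanned big_mkcond [leqRHS]big_mkcond leq_sum // => u _.
rewrite inE; case: (u \notin S) => //=; case: ifP => uV; last first.
  rewrite big1 // => v _; apply: mult_subset; apply: contraFN uV => /subsetP; apply.
  by rewrite !inE eqxx orbT.
rewrite big_mkcond [leqRHS]big_mkcond leq_sum // => v _.
rewrite !inE negb_or; case: (v \notin S); rewrite ?andbF ?andbT //=.
case: (v != u) => //=; case: ifP => // vV.
rewrite leqn0; apply/eqP; apply: mult_subset; apply: contraFN vV => /subsetP; apply.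
by rewrite !inE eqxx.
Qed.

(** * The bound for multihypergraphs *)

Local Open Scope ring_scope.

Lemma bin_le_exp (R : realFieldType) n j : 'C(n, j)%:R <= n%:R ^+ j / j`!%:R :> R.
Proof.
rewrite ler_pdivlMr ?ltr0n ?fact_gt0 // -natrX -natrM ler_nat bin_ffact.
elim: j n => [|j IHj] [|n] //; rewrite ffactSS expnS leq_mul //.
by rewrite (leq_trans (IHj n)) //; case: (j) => // i; rewrite leq_exp2r.
Qed.

(** Sum of the multigraph bounds over the links of all [r]-sets. A dense set [A]
    in the link of [S] gives the dense set [A :|: S] in the hypergraph: the
    number of edges is kept, and [r] vertices are added, which is how the
    excess [q] of the hypergraph turns into [p - 2] for the links. *)
Lemma free_nedges_lt (R : realFieldType) (r k p t : nat) (q : int) (T : finType)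
    (H : mhgraph r.+2 T) (d : R) :
  p%:Z = q + r.+2%:Z -> (0 < p)%N -> (1 < t)%N -> (t * p.+1 <= k)%N ->
  (0 < nverts H)%N -> 0 < d -> p%:R * (nverts H)%:R <= d ^+ t ->
  mhfree (@HM r.+2 k q) H ->
  (nedges H)%:R < 2 * (d + p%:R) / (r.+2)`!%:R * (nverts H)%:R ^+ r.+1.
Proof.
move=> p_def p_gt0 t_gt1 le_k n_gt0 d_gt0 le_d freeH.
set n := nverts H in n_gt0 le_d *.
have n_gt0R : 0 < n%:R :> R by rewrite ltr0n.
have p_gt0R : 0 < p%:R :> R by rewrite ltr0n.
pose b : R := 2 * (d + p%:R) * n%:R.
have b_gt0 : 0 < b by rewrite !mulr_gt0 ?addr_gt0.
have link_lt (S : {set T}) : (S \subset vset H) && (#|S| == r) ->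
    (spanned (link_graph H S) (vset H :\: S))%:R < b.
  case/andP=> SV /eqP cS; have rS : r.+2 = #|S|.+2 by rewrite cS.
  set V := vset H :\: S.
  have [->|V0] := eqVneq V set0; first by rewrite /spanned big_set0.
  have Vn : (#|V| <= n)%N by rewrite subset_leq_card // subsetDl.
  have lt_V : (spanned (link_graph H S) V)%:R < 2 * (d + p%:R) * #|V|%:R.
    apply: (sparse_spanned_lt (t := t)) => //.
    - exact: link_graph_sym.
    - by move=> u; apply: link_graph_irr.
    - by rewrite (le_trans _ le_d) // ler_pM2l // ler_nat.
    move=> A AV A_gt1 A_le.
    have dAS : [disjoint A & S].
      by rewrite disjoints_subset (subset_trans AV) // /V setDE subsetIr.
    have cAS : #|A :|: S| = (#|A| + r)%N.
      by rewrite cardsU disjoint_setI0 // cards0 subn0 cS.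
    have ASV : A :|: S \subset vset H.
      by rewrite subUset SV andbT (subset_trans AV) ?subsetDl.
    have p_ge : (p * t.-1 + p = p * t)%N by rewrite -mulnSr prednK // ltnW.
    have edges_lt : (\sum_(e : {set T} | e \subset A :|: S) mult H e <
                     #|A| + p - 1)%N.
      by apply: free_sparse freeH ASV _ _ _; rewrite ?cAS; nia.
    by have := spanned_link_le H rS dAS; lia.
  by rewrite (lt_le_trans lt_V) // ler_pM2l ?ler_nat // mulr_gt0 ?addr_gt0.
have total : (r.+2 * r.+1 * nedges H)%:R < n%:R ^+ r / r`!%:R * b :> R.
  have le_links := nedges_links H; rewrite -(ler_nat R) in le_links.
  apply: le_lt_trans le_links _; rewrite natr_sum.
  have [S0 S0P|no] := pickP (fun S : {set T} => (S \subset vset H) && (#|S| == r)).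
    apply: lt_le_trans (ler_wpM2r (ltW b_gt0) (bin_le_exp R n r)).
    rewrite mulr_natl -cards_draws -sumr_const.
    under [ltRHS]eq_bigl => S do rewrite inE.
    by apply: ltr_sum => //; apply/hasP; exists S0 => //; rewrite mem_index_enum.
  by rewrite big_pred0 // mulr_gt0 // divr_gt0 ?exprn_gt0 // ltr0n fact_gt0.
rewrite mulrAC ltr_pdivlMr ?ltr0n ?fact_gt0 //.
rewrite mulrAC ltr_pdivlMr ?ltr0n ?fact_gt0 // in total.
move: total; rewrite /b !factS !natrM exprS; lra.
Qed.

Theorem corollary8 (R : realType) (n k r : nat) (q : int)
    (hr : (2 <= r)%N) (hq : - r%:Z + 1 <= q)
    (hk : 2 * q + 2 * r%:Z + 2 <= k%:Z) (hn : (k <= n)%N) :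
  let l : R := ((k%:Z %/ (q + r%:Z + 1))%Z)%:~R in
  let C' : R := ((q + r%:Z)%:~R : R) `^ (1 / l) in
  exists m : nat,
    is_exM n (@HM r k q) m /\
    m%:R < 2 * C' / (r`!)%:R * (n%:R `^ (r%:R - 1 + 1 / l))
           + 2 * (q + r%:Z)%:~R / (r`!)%:R * n%:R ^+ (r - 1)%N.
Proof.
move=> l C'.
have [p p_def] : exists p : nat, q + r%:Z = p%:Z.
  by exists (absz (q + r%:Z)); rewrite gez0_abs //; lia.
have p_gt0 : (0 < p)%N by lia.
have n_gt0 : (0 < n)%N by lia.
pose t := (k %/ p.+1)%N.
have lE : l = t%:R.
  by rewrite /l p_def (_ : p%:Z + 1 = p.+1%:Z) ?divz_nat //; lia.
have t_gt1 : (1 < t)%N by rewrite leq_divRL //; lia.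
have t_neq0 : (t%:R : R) != 0 by rewrite pnatr_eq0; lia.
have n_gt0R : 0 < n%:R :> R by rewrite ltr0n.
have p_gt0R : 0 < p%:R :> R by rewrite ltr0n.
pose bound : R := 2 * C' / r`!%:R * (n%:R `^ (r%:R - 1 + 1 / l))
  + 2 * (q + r%:Z)%:~R / r`!%:R * n%:R ^+ (r - 1).
pose d : R := (p%:R * n%:R) `^ (1 / t%:R).
have d_gt0 : 0 < d by rewrite powR_gt0 // mulr_gt0.
have dt : d ^+ t = p%:R * n%:R.
  rewrite -powR_mulrn ?powR_ge0 // /d -powRrM mul1r mulVf //.
  by rewrite powRr1 // mulr_ge0 // ltW.
have free_lt (T : finType) (H : mhgraph r T) :
    nverts H = n -> mhfree (@HM r k q) H -> (nedges H)%:R < bound.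
  move=> Hn freeH.
  (* The two terms of the bound are the shares of [d] and of [p]. *)
  have boundE : bound = 2 * (d + p%:R) / r`!%:R * n%:R ^+ (r - 1).
    rewrite /bound /C' lE p_def -pmulrn /d powRM ?ler0n //.
    rewrite powRD; last by rewrite (gt_eqF n_gt0R) implybT.
    have -> : r%:R - 1 = (r - 1)%:R :> R by rewrite natrB //; lia.
    by rewrite powR_mulrn ?ler0n //; lra.
  rewrite {}boundE; clear -hr p_def H Hn freeH p_gt0 t_gt1 d_gt0 dt n_gt0.
  case: r hr p_def H Hn freeH => [|[|s]] // _ p_def H Hn freeH.
  rewrite subn1 -Hn.
  apply: (free_nedges_lt (k := k) (t := t) (q := q)) => //.
  - exact: leq_trunc_div.
  - by rewrite Hn.
  - by rewrite Hn dt.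
pose P m := `[< exists (T : finType) (H : mhgraph r T),
  [/\ nverts H = n, mhfree (@HM r k q) H & nedges H = m] >].
have exP : exists m, P m.
  exists 0%N; apply/asboolP.
  have no_edge (e : {set 'I_n}) :
      (0 < ([ffun=> 0%N] : {ffun {set 'I_n} -> nat}) e)%N ->
      #|e| = r /\ e \subset [set: 'I_n] by rewrite ffunE.
  exists 'I_n, (MHGraph no_edge); split.
  - by rewrite /nverts cardsT card_ord.
  - move=> [G [U [F [[_ GH] [_ F_ge] [f [f_bij fE]]]]]].
    have [e Fe] : exists e, (0 < mult F e)%N.
      apply/existsP; apply: contraTT F_ge; rewrite negb_exists => /forallP F0.
      rewrite /nedges big1 => [|e _]; first by lia.
      by apply/eqP; rewrite -leqn0 leqNgt.
    have [e' Ge'] := mhiso_edge (ex_intro _ f (conj f_bij fE)) Fe.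
    by have := leq_trans Ge' (GH e'); rewrite ffunE.
  - by rewrite /nedges big1 // => e _; rewrite ffunE.
have ubP m : P m -> (m <= Num.truncn bound)%N.
  move=> /asboolP[T [H [Hn freeH <-]]].
  by have := le_truncn (ltW (free_lt T H Hn freeH)); rewrite natrK.
case: (ex_maxnP exP ubP) => m /asboolP[T [H [Hn freeH Hm]]] m_max.
exists m; split; last by rewrite -Hm; apply: free_lt freeH.
split; first by exists T, H.
by move=> T' H' Hn' freeH'; apply: m_max; apply/asboolP; exists T', H'.
Qed.
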